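(* Let $G$ be a graph, $(m_n)_{n\in\mathbb N}\in\mathbb N^{\mathbb N}$ such that the limit $\lim_{n\to\infty}\frac{m_n}{n}=:\mu$ exists in $\mathbb R_{\ge0}$, and for each $n$ let $P_n\in\mathcal P_{m_n}(V(G))$ such that $P_n$ converges to some $P\in\mathcal P(V(G))$. Then $\left(G^{\boxtimes m_n}[T^{m_n}_{P_n}]\right)_{n\in\mathbb N}$ is an approximately geometric sequence in the semiring of graphs, and (for the given $G$) its asymptotic equivalence class only depends on $P$ and $\mu$.
   Context: Graphs are finite, simple and undirected. The semiring of graphs $\mathcal G$ consists of isomorphism classes of graphs with disjoint union $\sqcup$ as addition, strong product $\boxtimes$ as multiplication ($V(G\boxtimes H)=V(G)\times V(H)$, distinct vertices $(g,h),(g',h')$ being adjacent iff $g,g'$ are equal or adjacent and $h,h'$ are equal or adjacent), and the cohomomorphism preorder: $G\le H$ iff there is a graph homomorphism $\overline G\to\overline H$ between complements. Natural numbers $r$ correspond to the edgeless graphs $\overline{K_r}$; $2=\overline{K_2}$ is power universal. $G^{\boxtimes m}$ is the $m$-fold strong power (with $G^{\boxtimes0}=K_1$), with vertex set $V(G)^m$, and $G[S]$ is the subgraph induced on $S\subseteq V(G)$. Types: $\mathcal P(\mathcal X)$ is the set of probability distributions on the finite set $\mathcal X$; $\mathcal P_m(\mathcal X)$ is the set of $P\in\mathcal P(\mathcal X)$ with $mP(x)\in\mathbb N$ for all $x$. For $P\in\mathcal P_m(\mathcal X)$, $T^m_P\subseteq\mathcal X^m$ is the set of strings in which each $x\in\mathcal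 X$ occurs exactly $mP(x)$ times. $\mathbb N$ includes $0$; a sublinear sequence is a sequence $(k_n)_{n\in\mathbb N}$ in $\mathbb N$ with $k_n/n\to0$. Sequences $a,b$ in $\mathcal G$ are asymptotically equivalent, $a\approx b$, if for some sublinear $(k_n)$ one has $a_n\le\overline{K_2}^{\boxtimes k_n}\boxtimes b_n$ and $b_n\le\overline{K_2}^{\boxtimes k_n}\boxtimes a_n$ for all $n$. A sequence $a\in\mathcal G^{\mathbb N}$ is approximately geometric if either $a\approx(1,0,0,\dots)$, or all $a_n$ are nonempty graphs and there is a sublinear sequence $(k_n)$ such that for all $t\in\mathbb N_{>0}$ and $n_1,\dots,n_t\in\mathbb N$ both $a_{n_1}\boxtimes\cdots\boxtimes a_{n_t}\le\overline{K_2}^{\boxtimes(k_{n_1}+\dots+k_{n_t})}\boxtimes a_{n_1+\dots+n_t}$ and $a_{n_1+\dots+n_t}\le\overline{K_2}^{\boxtimes(k_{n_1}+\dots+k_{n_t})}\boxtimes a_{n_1}\boxtimes\cdots\boxtimes a_{n_t}$ hold. *)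

(* Defs.v *)
From HB Require Import structures.
From mathcomp Require Import all_boot all_order all_algebra.
From mathcomp Require Import all_classical all_reals all_analysis.

Set Implicit Arguments.
Unset Strict Implicit.
Unset Printing Implicit Defensive.

Import Order.TTheory GRing.Theory Num.Theory.
Import numFieldNormedType.Exports.

Local Open Scope classical_set_scope.
Local Open Scope ring_scope.

(* Elements of the semiring of graphs are isomorphism classes. Strong product
   and cohomomorphism preorder are invariant under isomorphism, so sequences in
   the semiring are represented by sequences of graphs. *)
Record graph := Graph {
  vertex :> finType;
  adj : rel vertex;
  adj_sym : symmetric adj;
  adj_irr : irreflexive adj }.
Arguments adj {g} _ _.

Definition adj_or_eq (G : graph) : rel G := fun x y => (x == y) || adj x y.
Arguments adj_or_eq {G} _ _.

Lemma adj_or_eq_sym (G : graph) : symmetric (@adj_or_eq G).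
Proof. by move=> x y; rewrite /adj_or_eq eq_sym adj_sym. Qed.

Definition compl_adj (G : graph) : rel G := fun x y => (x != y) && ~~ adj x y.

Lemma compl_adj_sym (G : graph) : symmetric (@compl_adj G).
Proof. by move=> x y; rewrite /compl_adj eq_sym adj_sym. Qed.

Lemma compl_adj_irr (G : graph) : irreflexive (@compl_adj G).
Proof. by move=> x; rewrite /compl_adj eqxx. Qed.

Definition compl (G : graph) : graph :=
  Graph (@compl_adj_sym G) (@compl_adj_irr G).

Definition complete_adj (r : nat) : rel 'I_r := fun x y => x != y.

Lemma complete_adj_sym (r : nat) : symmetric (@complete_adj r).
Proof. by move=> x y; rewrite /complete_adj eq_sym. Qed.

Lemma complete_adj_irr (r : nat) : irreflexive (@complete_adj r).
Proof. by move=> x; rewrite /complete_adj eqxx. Qed.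

Definition complete (r : nat) : graph :=
  Graph (@complete_adj_sym r) (@complete_adj_irr r).

(* The natural number r in the semiring of graphs. *)
Definition edgeless (r : nat) : graph := compl (complete r).

Definition graph_hom (G H : graph) : Prop :=
  exists f : G -> H, forall x y : G, adj x y -> adj (f x) (f y).

Definition cohom_le (G H : graph) : Prop := graph_hom (compl G) (compl H).

Definition strong_adj (G H : graph) : rel (G * H)%type := fun u v =>
  [&& u != v, adj_or_eq u.1 v.1 & adj_or_eq u.2 v.2].

Lemma strong_adj_sym (G H : graph) : symmetric (@strong_adj G H).
Proof.
by move=> u v; rewrite /strong_adj eq_sym !(adj_or_eq_sym u.1, adj_or_eq_sym u.2).
Qed.

Lemma strong_adj_irr (G H : graph) : irreflexive (@strong_adj G H).
Proof. by move=> u; rewrite /strong_adj eqxx. Qed.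

Definition strong (G H : graph) : graph :=
  Graph (@strong_adj_sym G H) (@strong_adj_irr G H).

(* The strong power is defined directly on strings; for m = 0 the only vertex is
   the empty string, so that it is a copy of K_1. *)
Definition strong_pow_adj (G : graph) (m : nat) : rel (m.-tuple G) := fun u v =>
  (u != v) && [forall i : 'I_m, adj_or_eq (tnth u i) (tnth v i)].

Lemma strong_pow_adj_sym (G : graph) (m : nat) :
  symmetric (@strong_pow_adj G m).
Proof.
move=> u v; rewrite /strong_pow_adj eq_sym; congr (_ && _).
by apply: eq_forallb => i; rewrite adj_or_eq_sym.
Qed.

Lemma strong_pow_adj_irr (G : graph) (m : nat) :
  irreflexive (@strong_pow_adj G m).
Proof. by move=> u; rewrite /strong_pow_adj eqxx. Qed.

Definition strong_pow (G : graph) (m : nat) : graph :=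
  Graph (@strong_pow_adj_sym G m) (@strong_pow_adj_irr G m).

Definition strong_prod (t : nat) (F : 'I_t -> graph) : graph :=
  \big[strong/complete 1]_(i < t) F i.

Definition induced_adj (G : graph) (S : {set G}) : rel {x : G | x \in S} :=
  fun u v => adj (val u) (val v).

Lemma induced_adj_sym (G : graph) (S : {set G}) : symmetric (@induced_adj G S).
Proof. by move=> u v; rewrite /induced_adj adj_sym. Qed.

Lemma induced_adj_irr (G : graph) (S : {set G}) :
  irreflexive (@induced_adj G S).
Proof. by move=> u; rewrite /induced_adj adj_irr. Qed.

Definition induced (G : graph) (S : {set G}) : graph :=
  Graph (@induced_adj_sym G S) (@induced_adj_irr G S).

Record fdist (R : realType) (X : finType) := FDist {
  pmf :> X -> R;
  pmf_ge0 : forall x, 0 <= pmf x;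
  pmf_sum1 : \sum_(x : X) pmf x = 1 }.

Definition is_type (R : realType) (X : finType) (m : nat) (P : fdist R X) :
  Prop := forall x : X, m%:R * P x \is a Num.nat.

Definition type_class (R : realType) (X : finType) (m : nat) (P : fdist R X) :
    {set m.-tuple X} :=
  [set u : m.-tuple X | [forall x : X, (count_mem x u)%:R == m%:R * P x]].

Definition type_graph (R : realType) (G : graph) (m : nat) (P : fdist R G) :
  graph := @induced (strong_pow G m) (type_class m P).

(* The value at n = 0 of the quotient (0 by convention) plays no role here. *)
Definition sublinear (R : realType) (k : nat -> nat) : Prop :=
  (fun n : nat => (k n)%:R / n%:R : R) @ \oo --> (0 : R).

Definition asymp_equiv (R : realType) (a b : nat -> graph) : Prop :=
  exists k : nat -> nat, sublinear R k /\
    forall n : nat,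
      cohom_le (a n) (strong (strong_pow (edgeless 2) (k n)) (b n)) /\
      cohom_le (b n) (strong (strong_pow (edgeless 2) (k n)) (a n)).

Definition approx_geometric (R : realType) (a : nat -> graph) : Prop :=
  asymp_equiv R a (fun n => if n == 0%N then edgeless 1 else edgeless 0) \/
  ((forall n : nat, (0 < #|a n|)%N) /\
   exists k : nat -> nat, sublinear R k /\
     forall (t : nat) (n : 'I_t -> nat), (0 < t)%N ->
       let two_pow := strong_pow (edgeless 2) (\sum_(i < t) k (n i))%N in
       let a_sum := a (\sum_(i < t) n i)%N in
       let a_prod := strong_prod (fun i => a (n i)) in
       cohom_le a_prod (strong two_pow a_sum) /\
       cohom_le a_sum (strong two_pow a_prod)).

(* Coordinatewise convergence is convergence in
   the simplex of distributions on a finite set. *)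
Definition type_sequence (R : realType) (X : finType) (mu : R) (P : fdist R X)
    (m : nat -> nat) (Pn : nat -> fdist R X) : Prop :=
  [/\ (fun n : nat => (m n)%:R / n%:R : R) @ \oo --> mu,
      forall n : nat, is_type (m n) (Pn n) &
      forall x : X, (fun n : nat => Pn n x) @ \oo --> P x].

(* Main.v *)
Require Import Defs.
From HB Require Import structures.
From mathcomp Require Import all_boot all_order all_algebra.
From mathcomp Require Import all_classical all_reals all_analysis.
From mathcomp Require Import fingroup perm zify ring lra.

(* All graphs involved are T(c), the strings with letter counts c; "up to N"
   below means up to a factor N in the semiring.
   - Comparison: T(c) <= T(c') up to the number of ways to place and fill the
     sum of the (c x - c' x)_+ letters in excess, since deleting them leaves a
     string that can be padded to one of T(c').  If c_n and c'_n both grow like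
     n v this number is 2^o(n); this gives the second claim and lets c_n be
     replaced by the floor or the ceiling of n v, where v = mu P.
   - Products below sums: concatenation embeds the product of the T(c_i) into
     T(sum c_i), and a sum of floors is at most the floor of the sum.
   - Sums below products: a ceiling is at most the sum of the ceilings, and
     translates of the product under permutations of positions cover
     T(sum c_i) economically.  Their number is, up to a logarithm, the ratio of
     cardinalities, which is at most a product of polynomials in the n_i: with
     P^c the product of the P(x)^c(x), one has #T(c) P^c <= 1 always, while
     #T(c) P^c is polynomially bounded below when c = ceil(n v).
   Rounding to floors or ceilings, rather than comparing T(sum c_i) with
   T(c_(sum n_i)) directly, is essential: when P vanishes somewhere, the latter
   comparison may cost more than the sum of the allowed o(n_i). *)

Import Order.TTheory GRing.Theory Num.Theory.
Import numFieldNormedType.Exports.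
Set Implicit Arguments.
Unset Strict Implicit.
Unset Printing Implicit Defensive.
Local Open Scope ring_scope.

(** * Adjacency or equality in products, powers and induced subgraphs *)

Lemma adj_or_eq_refl (G : graph) (x : G) : adj_or_eq x x.
Proof. by rewrite /adj_or_eq eqxx. Qed.

Lemma adj_or_eq_strong (G H : graph) (u v : strong G H) :
  adj_or_eq u v = adj_or_eq u.1 v.1 && adj_or_eq u.2 v.2.
Proof.
rewrite {1}/adj_or_eq /= /strong_adj; case: eqVneq => //= ->.
by rewrite !adj_or_eq_refl.
Qed.

Lemma all2_tnth (T : Type) (r : rel T) (m : nat) (u v : m.-tuple T) :
  all2 r u v = [forall i, r (tnth u i) (tnth v i)].
Proof.
elim: m u v => [|m IH] u v.
  by rewrite (tuple0 u) (tuple0 v) /=; apply/esym/forallP => -[].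
case/tupleP: u => x u; case/tupleP: v => y v /=; rewrite IH.
apply/andP/forallP => [[xy /forallP h] i|h].
  by case: (unliftP ord0 i) => [j|] ->; rewrite ?tnthS ?tnth0.
split; first by have := h ord0; rewrite !tnth0.
by apply/forallP => i; have := h (lift ord0 i); rewrite !tnthS.
Qed.

Lemma adj_or_eq_pow (G : graph) (m : nat) (u v : strong_pow G m) :
  adj_or_eq u v = all2 (@adj_or_eq G) (u : m.-tuple G) (v : m.-tuple G).
Proof.
rewrite all2_tnth {1}/adj_or_eq /= /strong_pow_adj; case: eqVneq => //= ->.
by apply/esym/forallP => i; rewrite adj_or_eq_refl.
Qed.

Lemma adj_or_eq_induced (G : graph) (S : {set G}) (u v : Defs.induced S) :
  adj_or_eq u v = adj_or_eq (val u) (val v).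
Proof. by rewrite /adj_or_eq /= /induced_adj val_eqE. Qed.

Lemma adj_or_eq_edgeless (r : nat) (u v : edgeless r) : adj_or_eq u v = (u == v).
Proof.
by rewrite /adj_or_eq /= /compl_adj /= /complete_adj; case: eqVneq.
Qed.

Lemma compl_adjE (G : graph) (x y : G) : compl_adj x y = ~~ adj_or_eq x y.
Proof. by rewrite /compl_adj /adj_or_eq negb_or. Qed.

(** * Cohomomorphism up to an edgeless factor *)

Lemma cohom_leP (G H : graph) :
  cohom_le G H <->
  exists f : G -> H, forall x y, adj_or_eq (f x) (f y) -> adj_or_eq x y.
Proof.
split=> -[f hf]; exists f => x y; have := hf x y; rewrite /= !compl_adjE.
- by apply: contraLR => xy; exact: hf.
- exact: contra.
Qed.

(* [cle N G H] stands for [cohom_le G (strong (edgeless N) H)]. *)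
Definition cle (N : nat) (G H : graph) : Prop :=
  exists (K : finType) (g : G -> K) (f : G -> H),
    (#|K| <= N)%N /\
    forall x y, g x = g y -> adj_or_eq (f x) (f y) -> adj_or_eq x y.

Lemma cle_cohom_le (k N : nat) (G H : graph) : (N <= 2 ^ k)%N -> cle N G H ->
  cohom_le G (strong (strong_pow (edgeless 2) k) H).
Proof.
move=> Nk [K [g [f [KN hf]]]]; apply/cohom_leP.
have card_pow : #|{: k.-tuple (edgeless 2)}| = (2 ^ k)%N by rewrite card_tuple card_ord.
have hK : (#|K| <= #|{: k.-tuple (edgeless 2)}|)%N.
  by rewrite card_pow (leq_trans KN).
pose e (x : K) : strong_pow (edgeless 2) k := enum_val (widen_ord hK (enum_rank x)).
have e_inj : injective e.
  by move=> x y /enum_val_inj /(congr1 val) /= /val_inj /enum_rank_inj.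
exists (fun x => (e (g x), f x)) => x y.
rewrite adj_or_eq_strong /= => /andP[gxy fxy]; apply: hf => //; apply: e_inj.
(* Over an edgeless graph, adjacent or equal means equal, so the two words agree letter by
   letter. *)
move: gxy; rewrite adj_or_eq_pow all2E !size_tuple eqxx /= => h.
apply/val_inj => /=; move: h.
have : size (e (g x) : k.-tuple _) = size (e (g y) : k.-tuple _) by rewrite !size_tuple.
elim: (tval (e (g x))) (tval (e (g y))) => [|a s IH] [|b t] //= [st] /andP[].
by rewrite adj_or_eq_edgeless => /eqP -> /(IH _ st) ->.
Qed.

Lemma cle_refl (G : graph) : cle 1 G G.
Proof. by exists unit, (fun=> tt), id; rewrite card_unit. Qed.

Lemma cle_leq (N M : nat) (G H : graph) : (N <= M)%N -> cle N G H -> cle M G H.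
Proof. by move=> NM [K [g [f [KN h]]]]; exists K, g, f; rewrite (leq_trans KN). Qed.

Lemma cle_trans (N M : nat) (F G H : graph) :
  cle N F G -> cle M G H -> cle (N * M) F H.
Proof.
move=> [K [g [f [KN hf]]]] [K' [g' [f' [KM hf']]]].
exists (K * K')%type, (fun x => (g x, g' (f x))), (f' \o f).
rewrite card_prod leq_mul //; split=> // x y [gxy gxy'] /= h.
by apply: hf => //; exact: hf'.
Qed.

Lemma cle_strong (N M : nat) (F G H I : graph) :
  cle N F G -> cle M H I -> cle (N * M) (strong F H) (strong G I).
Proof.
move=> [K [g [f [KN hf]]]] [K' [g' [f' [KM hf']]]].
exists (K * K')%type, (fun x => (g x.1, g' x.2)), (fun x => (f x.1, f' x.2)).
rewrite card_prod leq_mul //; split=> // x y [gxy gxy'] /=.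
by rewrite !adj_or_eq_strong /= => /andP[h h']; rewrite hf //= hf'.
Qed.

Lemma strong_prodS (t : nat) (F : 'I_t.+1 -> graph) :
  strong_prod F = strong (F ord0) (strong_prod (fun i => F (lift ord0 i))).
Proof. by rewrite /strong_prod big_ord_recl. Qed.

Lemma strong_prod0 (F : 'I_0 -> graph) : strong_prod F = complete 1.
Proof. by rewrite /strong_prod big_ord0. Qed.

Lemma cle_strong_prod (t : nat) (N : 'I_t -> nat) (F G : 'I_t -> graph) :
  (forall i, cle (N i) (F i) (G i)) ->
  cle (\prod_(i < t) N i)%N (strong_prod F) (strong_prod G).
Proof.
elim: t N F G => [|t IH] N F G h.
  by rewrite !strong_prod0 big_ord0; exact: cle_refl.
by rewrite !strong_prodS big_ord_recl; apply: cle_strong => //; exact: IH.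
Qed.

Lemma card_strong_prod (t : nat) (F : 'I_t -> graph) :
  #|strong_prod F| = (\prod_(i < t) #|F i|)%N.
Proof.
elim: t F => [|t IH] F; first by rewrite strong_prod0 big_ord0 card_ord.
by rewrite strong_prodS big_ord_recl card_prod IH.
Qed.

(** Preserving [adj_or_eq] alone would allow adjacent twins to be identified; injectivity keeps the
    image as large as [G], which the covering argument counts. *)
Definition embeds (G H : graph) : Prop :=
  exists f : G -> H, injective f /\ forall x y, adj_or_eq (f x) (f y) = adj_or_eq x y.

Lemma embeds_cle (G H : graph) : embeds G H -> cle 1 G H.
Proof.
move=> [f [_ hf]]; exists unit, (fun=> tt), f; rewrite card_unit; split=> // x y _.
by rewrite hf.
Qed.

Lemma embeds_trans (F G H : graph) : embeds F G -> embeds G H -> embeds F H.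
Proof.
move=> [f [fi hf]] [g [gi hg]]; exists (g \o f); split; first exact: inj_comp.
by move=> x y /=; rewrite hg hf.
Qed.

Lemma embeds_strong (F G H : graph) : embeds G H -> embeds (strong F G) (strong F H).
Proof.
move=> [f [fi hf]]; exists (fun x => (x.1, f x.2)); split.
  by move=> [a b] [c d] /= [-> /fi ->].
by move=> x y; rewrite !adj_or_eq_strong /= hf.
Qed.

(** * Strings with prescribed letter counts *)

Definition count_class (X : finType) (m : nat) (c : X -> nat) : {set m.-tuple X} :=
  [set u : m.-tuple X | [forall x, count_mem x u == c x]].

Lemma count_classP (X : finType) (m : nat) (c : X -> nat) (u : m.-tuple X) :
  reflect (forall x, count_mem x u = c x) (u \in count_class m c).
Proof.
rewrite inE; apply: (iffP forallP) => h x; first exact/eqP.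
by apply/eqP.
Qed.

(** Integer counts replace types so that floors, ceilings and sums of counts need no division by
    [m]. *)
Definition count_graph (G : graph) (m : nat) (c : G -> nat) : graph :=
  @Defs.induced (strong_pow G m) (count_class m c).

Lemma count_graphP (G : graph) (m : nat) (c : G -> nat) (u : count_graph m c) :
  forall x, count_mem x (val u : m.-tuple G) = c x.
Proof. by case: u => u hu; exact/count_classP. Qed.

Lemma adj_or_eq_count (G : graph) (m : nat) (c : G -> nat) (u v : count_graph m c) :
  adj_or_eq u v = all2 (@adj_or_eq G) (val u : m.-tuple G) (val v : m.-tuple G).
Proof. by rewrite adj_or_eq_induced adj_or_eq_pow. Qed.

Definition mk_count (G : graph) (m : nat) (c : G -> nat) (u : m.-tuple G)
    (h : forall x, count_mem x u = c x) : count_graph m c :=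
  Sub u (introT (count_classP c u) h).

Lemma card_count_graph (G : graph) (m : nat) (c : G -> nat) :
  #|count_graph m c| = #|count_class m c|.
Proof. by rewrite card_sig; apply: eq_card => u; rewrite inE. Qed.

Lemma sum_count (X : finType) (u : seq X) : (\sum_x count_mem x u)%N = size u.
Proof.
elim: u => [|a u IH] /=; first by rewrite big1.
rewrite big_split /= IH (bigD1 a) //= eqxx big1 // => x /negbTE.
by rewrite eq_sym => ->.
Qed.

Definition blocks (X : finType) (c : X -> nat) : seq X :=
  flatten [seq nseq (c x) x | x <- enum X].

Lemma count_blocks (X : finType) (c : X -> nat) (x : X) :
  count_mem x (blocks c) = c x.
Proof.
rewrite /blocks count_flatten -map_comp sumnE big_map big_enum /=.
rewrite (bigD1 x) //= count_nseq /= eqxx mul1n big1 ?addn0 // => y /negbTE yx.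
by rewrite count_nseq /= yx.
Qed.

Lemma size_blocks (X : finType) (c : X -> nat) : size (blocks c) = (\sum_x c x)%N.
Proof. by rewrite -sum_count; apply: eq_bigr => x _; rewrite count_blocks. Qed.

Lemma count_class_nonempty (X : finType) (m : nat) (c : X -> nat) :
  (\sum_x c x)%N = m -> (0 < #|count_class m c|)%N.
Proof.
move=> cm; have s : size (blocks c) == m by rewrite size_blocks cm.
apply/card_gt0P; exists (Tuple s); apply/count_classP => x /=.
exact: count_blocks.
Qed.

Lemma all2_cat (T : Type) (r : rel T) (s s' t t' : seq T) : size s = size t ->
  all2 r (s ++ s') (t ++ t') = all2 r s t && all2 r s' t'.
Proof.
elim: s t => [|a s IH] [|b t] //= [st].
by rewrite (IH _ st) andbA.
Qed.

Lemma embeds_cat (G : graph) (m n : nat) (c d e : G -> nat) :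
  (forall x, e x = c x + d x)%N ->
  embeds (strong (count_graph m c) (count_graph n d)) (count_graph (m + n) e).
Proof.
move=> hc.
have cnt (w : strong (count_graph m c) (count_graph n d)) x :
    count_mem x [tuple of (val w.1 : m.-tuple G) ++ (val w.2 : n.-tuple G)] = e x.
  by rewrite /= count_cat !count_graphP hc.
exists (fun w => mk_count (cnt w)); split.
  move=> [a b] [a' b'] /(congr1 val) /(congr1 val) /= /eqP.
  rewrite eqseq_cat ?size_tuple // => /andP[/eqP h /eqP h'].
  by congr pair; do 2 apply: val_inj.
move=> u v; rewrite adj_or_eq_strong !adj_or_eq_count /= all2_cat //.
by rewrite !size_tuple.
Qed.

Lemma embeds_strong_prod (G : graph) (t : nat) (m : 'I_t -> nat)
    (c : 'I_t -> G -> nat) (e : G -> nat) :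
  (forall x, e x = \sum_(i < t) c i x)%N ->
  embeds (strong_prod (fun i => count_graph (m i) (c i)))
         (count_graph (\sum_(i < t) m i) e).
Proof.
elim: t m c e => [|t IH] m c e he.
  rewrite strong_prod0 big_ord0.
  have cnt x : count_mem x [tuple of @nil G] = e x by rewrite he big_ord0.
  by exists (fun=> mk_count cnt); split=> x y; rewrite ?adj_or_eq_refl !ord1 ?adj_or_eq_refl.
rewrite strong_prodS big_ord_recl.
apply: embeds_trans (@embeds_cat _ _ _ (c ord0)
    (fun x => \sum_(i < t) c (lift ord0 i) x)%N e _).
  by apply: embeds_strong; exact: IH.
by move=> x; rewrite he big_ord_recl.
Qed.

(** * Comparison of different letter counts *)

Lemma cle_count_mono (G : graph) (m n : nat) (c d : G -> nat) :
  (\sum_x c x)%N = m -> (\sum_x d x)%N = n -> (forall x, c x <= d x)%N ->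
  cle 1 (count_graph m c) (count_graph n d).
Proof.
(* One fixed word [w] of missing letters pads every string; adjacency of padded strings passes to
   their prefixes. *)
move=> cm dn cd; pose w := blocks (fun x => d x - c x)%N.
have sw (u : count_graph m c) : size ((val u : m.-tuple G) ++ w) == n.
  rewrite size_cat size_tuple size_blocks -cm -dn -big_split /=.
  by apply/eqP/eq_bigr => x _; rewrite subnKC.
have cnt u x : count_mem x (Tuple (sw u)) = d x.
  by rewrite /= count_cat count_graphP count_blocks subnKC.
exists unit, (fun=> tt), (fun u => mk_count (cnt u)); rewrite card_unit.
split=> // u v _; rewrite !adj_or_eq_count /= all2_cat ?size_tuple //.
by case/andP.
Qed.

(** Reading from the left, the first [q x] occurrences of each letter [x] are kept. Here [None]
    marks a kept position and [Some x] a deleted letter, while [split_kept] lists the kept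
    letters. *)
Fixpoint split_code (X : eqType) (q : X -> nat) (u : seq X) : seq (option X) :=
  if u is x :: u' then
    if (0 < q x)%N then None :: split_code (fun y => q y - (y == x))%N u'
    else Some x :: split_code q u'
  else [::].

Fixpoint split_kept (X : eqType) (q : X -> nat) (u : seq X) : seq X :=
  if u is x :: u' then
    if (0 < q x)%N then x :: split_kept (fun y => q y - (y == x))%N u'
    else split_kept q u'
  else [::].

Lemma size_split_code (X : eqType) (q : X -> nat) (u : seq X) :
  size (split_code q u) = size u.
Proof. by elim: u q => //= x u IH q; case: ifP => _ /=; rewrite IH. Qed.

Lemma count_split_code (X : eqType) (q : X -> nat) (u : seq X) :
  (count isSome (split_code q u) + size (split_kept q u))%N = size u.
Proof.
by elim: u q => //= x u IH q; case: ifP => _ /=; rewrite ?addSn ?addnS ?add0n IH.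
Qed.

Lemma count_split_kept (X : eqType) (q : X -> nat) (u : seq X) (x : X) :
  count_mem x (split_kept q u) = minn (q x) (count_mem x u).
Proof.
elim: u q => [|a u IH] q /=; first by rewrite minn0.
case: ifP => qa /=; rewrite IH (eq_sym a x); case: eqVneq => [->|_] /=; lia.
Qed.

(** Equal codes delete the same letters at the same positions, which aligns the kept words. Kept
    letters of [u] and [v] may differ, so the induction lowers two separate quotas. *)
Lemma all2_split (X : eqType) (r : rel X) (q q' : X -> nat) (u v : seq X) :
  reflexive r -> split_code q u = split_code q' v ->
  all2 r (split_kept q u) (split_kept q' v) -> all2 r u v.
Proof.
move=> rr; elim: u v q q' => [|x u IH] [|y v] q q' /=.
- by [].
- by case: ifP.
- by case: ifP.
case: ifP => qx; case: ifP => qy //= [].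
  by move=> /IH h /andP[-> /h].
by move=> -> /IH h /h ->; rewrite rr.
Qed.

Definition codes (X : finType) (m d : nat) : {set m.-tuple (option X)} :=
  [set w : m.-tuple (option X) | count isSome w == d].

(* Delete from a string the letters in excess, and record their positions and
   values in a word over [option X]. *)
Lemma cle_count (G : graph) (m n : nat) (c d : G -> nat) :
  (\sum_x c x)%N = m -> (\sum_x d x)%N = n ->
  cle #|codes G m (\sum_x (c x - d x))| (count_graph m c) (count_graph n d).
Proof.
move=> cm dn; rewrite -[#|_|]muln1.
(* Deletion leaves exactly [e x] letters [x]; padding then leads from [e] to [d]. *)
pose e x := minn (d x) (c x).
apply: cle_trans (@cle_count_mono G (\sum_x e x) n e d _ _ _) => //; last first.
  by move=> x; exact: geq_minl.
have cnt (u : count_graph m c) x :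
    count_mem x (split_kept d (val u : m.-tuple G)) = e x.
  by rewrite count_split_kept count_graphP.
have sk (u : count_graph m c) :
    size (split_kept d (val u : m.-tuple G)) == (\sum_x e x)%N.
  by rewrite -sum_count; apply/eqP/eq_bigr => x _; exact: cnt.
have sc (u : count_graph m c) : size (split_code d (val u : m.-tuple G)) == m.
  by rewrite size_split_code size_tuple.
have hc (u : count_graph m c) : Tuple (sc u) \in codes G m (\sum_x (c x - d x))%N.
  rewrite inE /=; have := count_split_code d (val u : m.-tuple G).
  rewrite (eqP (sk u)) size_tuple => h.
  have : (\sum_x c x = \sum_x (c x - d x) + \sum_x e x)%N.
    by rewrite -big_split /=; apply: eq_bigr => x _; rewrite /e; lia.
  by rewrite cm => h'; apply/eqP/(addIn (etrans h h')).
exists {w | w \in codes G m (\sum_x (c x - d x))%N}.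
exists (fun u => Sub (Tuple (sc u)) (hc u)).
exists (fun u => @mk_count G _ e (Tuple (sk u)) (cnt u)).
split; first by rewrite card_sig; apply/eq_leq/eq_card => w; rewrite inE.
move=> u v /(congr1 val) /(congr1 val) /= cuv.
rewrite !adj_or_eq_count /=; apply: all2_split cuv => //.
exact: adj_or_eq_refl.
Qed.

(** * Counting words with few recorded letters *)

Lemma sum_tuple_cons (R : nmodType) (T : finType) (m : nat) (F : m.+1.-tuple T -> R) :
  \sum_w F w = \sum_x \sum_(w : m.-tuple T) F (cons_tuple x w).
Proof.
rewrite pair_big /= (reindex (fun p : T * m.-tuple T => cons_tuple p.1 p.2)) //.
exists (fun w : m.+1.-tuple T => (thead w, [tuple of behead w])).
  by move=> [x w] _ /=; congr pair; apply/val_inj.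
by move=> w _ /=; rewrite [RHS]tuple_eta; apply/val_inj.
Qed.

Lemma sum_tuple_prod (R : comPzSemiRingType) (T : finType) (m : nat) (f : T -> R) :
  \sum_(w : m.-tuple T) \prod_(x <- w) f x = (\sum_x f x) ^+ m.
Proof.
elim: m => [|m IH].
  rewrite (bigD1 [tuple]) //= big_nil big1 ?addr0 // => w /negP[].
  by rewrite (tuple0 w); exact/eqP.
rewrite exprS -IH big_distrlr sum_tuple_cons /=.
by apply: eq_bigr => x _; apply: eq_bigr => w _; rewrite big_cons.
Qed.

Lemma sum_tuple_prodn (T : finType) (m : nat) (f : T -> nat) :
  (\sum_(w : m.-tuple T) \prod_(x <- w) f x = (\sum_x f x) ^ m)%N.
Proof. by rewrite -natrXE; exact: (@sum_tuple_prod nat). Qed.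

(** Give the letter [None] weight [q] and every other letter weight 1. All words together weigh
    [(q + #|X|) ^ m], and a word with [d] recorded letters weighs [q ^ (m - d)]; the factor [q ^ d]
    avoids the subtraction. *)
Lemma card_codes (X : finType) (m d q : nat) :
  (#|codes X m d| * q ^ m <= q ^ d * (q + #|X|) ^ m)%N.
Proof.
pose f (o : option X) := if o is Some _ then 1%N else q.
have sf : (\sum_o f o = q + #|X|)%N.
  rewrite (bigD1 None) //=; congr (_ + _)%N.
  rewrite (eq_bigr (fun=> 1%N)) => [|[] //].
  by rewrite sum1_card cardC1 card_option.
rewrite -sf -sum_tuple_prodn big_distrr /= -sum_nat_const.
rewrite [leqRHS](bigID (mem (codes X m d))) /=.
apply: leq_trans (leq_addr _ _); apply: leq_sum => w; rewrite inE => /eqP <-.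
have -> : (\prod_(x <- w) f x = q ^ count (predC isSome) w)%N.
  rewrite -{1}[tval w]/(tval w); elim: (tval w) => [|[x|] s IH] /=.
  - by rewrite big_nil.
  - by rewrite big_cons IH mul1n.
  - by rewrite big_cons IH expnS.
by rewrite -expnD count_predC size_tuple.
Qed.

(** * Covering by translates under a transitive group action *)

Section Covering.
Variables (gT : finGroupType) (V : finType) (act : gT -> V -> V).
Hypothesis actM : forall g h b, act (g * h)%g b = act g (act h b).
Hypothesis act_trans : forall b s, exists g, act g b = s.

(** Left multiplication by an element moving [t] to [s] matches the elements sending [b] to [t] with
    those sending [b] to [s], so these [#|V|] sets split the group evenly. *)
Lemma card_amove (b s : V) : (#|[set g | act g b == s]| * #|V| = #|gT|)%N.
Proof.
have eq_card2 (t : V) : #|[set g | act g b == t]| = #|[set g | act g b == s]|.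
  have [h hts] := act_trans t s.
  (* The identity acts trivially because each [c] has the form [act g c]. *)
  have act1 c : act 1%g c = c.
    have [g <-] := act_trans c c.
    by rewrite -actM mul1g.
  rewrite -(card_imset _ (mulgI h)); apply: eq_card => g; rewrite inE.
  apply/imsetP/eqP => [[k]|gs].
    by rewrite inE => /eqP kt ->; rewrite actM kt.
  exists (h^-1 * g)%g; last by rewrite mulKVg.
  by rewrite inE actM gs -hts -actM mulVg act1.
transitivity (\sum_t #|[set g | act g b == t]|)%N.
  by rewrite (eq_bigr _ (fun t _ => eq_card2 t)) sum_nat_const mulnC.
rewrite -[RHS]sum1_card (partition_big (act^~ b) predT) //=.
by apply: eq_bigr => t _; rewrite -sum1_card; apply: eq_bigl => g; rewrite inE.
Qed.

(** Double counting: each pair of [b] in [U] and [s] in [S] is realised by [#|gT| / #|V|] group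
    elements. *)
Lemma sum_card_hits (U S : {set V}) :
  ((\sum_g #|[set b in U | act g b \in S]|) * #|V| = #|U| * #|S| * #|gT|)%N.
Proof.
transitivity ((\sum_(b in U) \sum_(s in S) #|[set g | act g b == s]|) * #|V|)%N.
  congr muln; transitivity (\sum_g \sum_(b in U) (act g b \in S))%N.
    apply: eq_bigr => g _; rewrite -sum1_card big_mkcond [RHS]big_mkcond /=.
    by apply: eq_bigr => b _; rewrite inE; case: (b \in U).
  rewrite exchange_big /=; apply: eq_bigr => b _.
  transitivity (\sum_g \sum_(s in S) (act g b == s))%N.
    apply: eq_bigr => g _; case: (boolP (act g b \in S)) => [gS|gS].
      by rewrite (bigD1 (act g b)) //= eqxx big1 // => s /andP[_ /negbTE]; rewrite eq_sym => ->.
    by rewrite big1 // => s sS; case: eqP => // gs; rewrite gs sS in gS.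
  rewrite exchange_big /=; apply: eq_bigr => s _.
  by rewrite -sum1_card [RHS]big_mkcond; apply: eq_bigr => g _; rewrite inE.
rewrite big_distrl /= -mulnA -sum_nat_const; apply: eq_bigr => b _.
rewrite big_distrl /= -sum_nat_const; apply: eq_bigr => s _.
exact: card_amove.
Qed.

Variables (S : {set V}) (r : nat).
Hypothesis card_VS : (#|V| <= r * #|S|)%N.

(** Averaging: a random [g] sends [#|U| * #|S| / #|V|] points of [U] into [S] in the mean, which is
    at least [#|U| / r]. *)
Lemma exists_good_translate (U : {set V}) :
  exists g, (#|U| <= r * #|[set b in U | act g b \in S]|)%N.
Proof.
apply/existsP; apply: contraT; rewrite negb_exists => /forallP h.
have U0 : (0 < #|U|)%N by have := h 1%g; lia.
have G0 : (0 < #|gT|)%N by apply/card_gt0P; exists 1%g.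
have V0 : (0 < #|V|)%N.
  by have /card_gt0P[b _] := U0; apply/card_gt0P; exists b.
have : (r * \sum_g #|[set b in U | act g b \in S]| < #|U| * #|gT|)%N.
  rewrite big_distrr /= mulnC -sum_nat_const.
  rewrite (bigD1 1%g) //= [ltnRHS](bigD1 1%g) //=.
  rewrite -addSn leq_add //; first by rewrite ltnNge; exact: h.
  by apply: leq_sum => g _; apply: ltnW; rewrite ltnNge; exact: h.
rewrite -(ltn_pmul2r V0) -mulnA sum_card_hits.
have : (#|U| * #|gT| * #|V| <= #|U| * #|gT| * (r * #|S|))%N by rewrite leq_mul2l card_VS orbT.
lia.
Qed.

Definition uncovered (gs : seq gT) (U : {set V}) : {set V} :=
  [set b in U | ~~ has (fun g => act g b \in S) gs].

Lemma uncovered_cat (gs hs : seq gT) (U : {set V}) :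
  uncovered (gs ++ hs) U = uncovered hs (uncovered gs U).
Proof. by apply/setP => b; rewrite !inE has_cat negb_or andbA. Qed.

(** Greedy choice: while more than half of [U] is uncovered, a good translate covers at least
    [#|U| / (2 * r)] further points. The second alternative records this without subtraction. *)
Lemma cover_half (j : nat) (U : {set V}) : exists gs, size gs = j /\
  ((2 * #|uncovered gs U| <= #|U|) \/
   (j * #|U| + 2 * r * #|uncovered gs U| <= 2 * r * #|U|))%N.
Proof.
elim: j => [|j [gs [sgs h]]].
  exists [::]; split=> //; right.
  rewrite mul0n add0n leq_mul2l subset_leq_card ?orbT //.
  by apply/fintype.subsetP => b; rewrite inE => /andP[].
have [g hg] := exists_good_translate (uncovered gs U).
exists (gs ++ [:: g]); rewrite size_cat sgs addn1; split=> //.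
rewrite uncovered_cat; set U' := uncovered gs U in h hg *.
have e : (#|[set b in U' | act g b \in S]| + #|uncovered [:: g] U'| = #|U'|)%N.
  rewrite -[RHS]sum1_card (bigID (fun b => act g b \in S)) /= -!sum1_card.
  by congr addn; apply: eq_bigl => b; rewrite !inE /= ?orbF.
have [h1|h1] := leqP (2 * #|U'|) #|U|; first by left; lia.
case: h => [|h]; first by lia.
by right; nia.
Qed.

Lemma exists_cover (l : nat) (U : {set V}) : (0 < r)%N -> (#|U| < 2 ^ l)%N ->
  exists gs, (size gs <= r * l)%N /\ uncovered gs U = finset.set0.
Proof.
move=> r0; elim: l U => [|l IH] U.
  rewrite ltnS leqn0 cards_eq0 => /eqP ->; exists [::]; split=> //.
  by apply/setP => b; rewrite !inE.
(* For [j = r] either alternative leaves at most half of [U], so [l] rounds leave nothing. *)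
have [gs [sgs hgs]] := cover_half r U; rewrite expnS => hU.
have [hs [shs ehs]] : exists hs, (size hs <= r * l)%N /\
    uncovered hs (uncovered gs U) = finset.set0.
  by apply: IH; case: hgs => ?; nia.
by exists (gs ++ hs); rewrite uncovered_cat size_cat sgs ehs; split=> //; nia.
Qed.

End Covering.

(** Each vertex of [B] is carried into the copy of [A] by some translate; its colour is the index of
    the first one. Vertices of equal colour are moved by the same group element, so adjacency in [A]
    pulls back to [B]. *)
Lemma cle_cover (gT : finGroupType) (A B : graph) (act : gT -> B -> B) (r l : nat) :
  (forall g h b, act (g * h)%g b = act g (act h b)) ->
  (forall b s, exists g, act g b = s) ->
  (forall g x y, adj_or_eq (act g x) (act g y) -> adj_or_eq x y) ->
  embeds A B -> (0 < r)%N -> (#|B| <= r * #|A|)%N -> (#|B| < 2 ^ l)%N ->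
  cle (r * l) B A.
Proof.
move=> actM act_trans act_adj [f [fi hf]] r0 BrA Bl.
pose S : {set B} := f @: A.
have BS : (#|B| <= r * #|S|)%N by rewrite card_imset.
have Bl' : (#|[set: B]| < 2 ^ l)%N by rewrite cardsT.
have [gs [sgs egs]] := exists_cover actM act_trans BS r0 Bl'.
have hit b : has (fun g => act g b \in S) gs.
  by apply: contraT => nb; move/setP/(_ b): egs; rewrite !inE nb.
pose i b := find (fun g => act g b \in S) gs.
have is_lt b : (i b < r * l)%N by rewrite (leq_trans _ sgs) // -has_find.
have hitP b : exists a, act (nth 1%g gs (i b)) b == f a.
  by have /imsetP[a _ ->] := nth_find 1%g (hit b); exists a.
exists 'I_(r * l), (fun b => Ordinal (is_lt b)), (fun b => xchoose (hitP b)).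
rewrite card_ord; split=> // x y /(congr1 val) /= ixy; rewrite -hf -!(eqP (xchooseP (hitP _))).
rewrite ixy; exact: act_adj.
Qed.

(** * Permuting the positions of a string *)

Definition perm_tuple (T : Type) (m : nat) (s : 'S_m) (u : m.-tuple T) : m.-tuple T :=
  [tuple tnth u (s i) | i < m].

(** In ['S_m] the product [s * t] applies [s] first, so reading a string through a permutation is a
    left action. *)
Lemma perm_tupleM (T : Type) (m : nat) (s t : 'S_m) (u : m.-tuple T) :
  perm_tuple (s * t)%g u = perm_tuple s (perm_tuple t u).
Proof. by apply: eq_from_tnth => i; rewrite !tnth_mktuple permM. Qed.

(** Strings with equal letter counts are permutations of each other, so the symmetric group acts
    transitively on them. *)
Lemma cle_count_cover (G : graph) (A : graph) (m : nat) (c : G -> nat) (r l : nat) :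
  embeds A (count_graph m c) -> (0 < r)%N ->
  (#|count_class m c| <= r * #|A|)%N -> (#|count_class m c| < 2 ^ l)%N ->
  cle (r * l) (count_graph m c) A.
Proof.
rewrite -!card_count_graph => emb r0 hr hl.
have cnt (s : 'S_m) (u : count_graph m c) x :
    count_mem x (perm_tuple s (val u : m.-tuple G)) = c x.
  rewrite -(count_graphP u x); apply/seq.permP.
  by apply/tuple_permP; exists s.
pose act s u := mk_count (cnt s u).
apply: (@cle_cover _ _ _ act) => //.
- by move=> s t u; apply: val_inj; rewrite /= perm_tupleM.
- move=> u v.
  have /tuple_permP[s hs] : perm_eq (val v : m.-tuple G) (val u : m.-tuple G).
    by apply/allP => x _; rewrite /= !count_graphP.
  by exists s; do 2 apply: val_inj => /=; rewrite hs.
- move=> s u v; rewrite !adj_or_eq_count => h.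
  have {h} : all2 (@adj_or_eq G) (perm_tuple s (val u : m.-tuple G))
    (perm_tuple s (val v : m.-tuple G)) := h.
  rewrite !all2_tnth => /forallP h.
  apply/forallP => i; have := h ((s^-1)%g i).
  by rewrite !tnth_mktuple permKV.
Qed.

(** * Cardinalities and probabilities of type classes *)

Lemma card_count_class_rec (X : finType) (m : nat) (c : X -> nat) :
  #|count_class m.+1 c| =
  (\sum_(x | 0 < c x) #|count_class m (fun y => c y - (y == x))|)%N.
Proof.
rewrite -sum1_card big_mkcond /= (@sum_tuple_cons nat) [RHS]big_mkcond /=.
apply: eq_bigr => x _.
transitivity (\sum_(w : m.-tuple X)
    if (0 < c x)%N && (w \in count_class m (fun y => c y - (y == x))%N) then 1 else 0)%N.
  apply: eq_bigr => w _; congr (if _ then _ else _).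
  apply/count_classP/andP => /= [h|[c0 /count_classP h] y].
    split; first by rewrite -(h x) eqxx.
    by apply/count_classP => y; rewrite -(h y) eq_sym addKn.
  by rewrite (h y) eq_sym; case: (eqVneq y x) => [->|_] //=; lia.
case: ifP => _ /=; last by rewrite big1.
by rewrite -big_mkcond sum1_card.
Qed.

(** The multinomial formula without division; removing the first letter gives the induction. *)
Lemma card_count_class (X : finType) (m : nat) (c : X -> nat) :
  (\sum_x c x)%N = m -> (#|count_class m c| * \prod_x (c x)`! = m`!)%N.
Proof.
elim: m c => [|m IH] c hc.
  have c0 x : c x = 0%N.
    by apply/eqP; rewrite -leqn0 -hc (bigD1 x) //= leq_addr.
  rewrite big1 => [|x _]; last by rewrite c0.
  rewrite muln1; apply/eqP; rewrite eqn_leq (leq_trans (max_card _)) ?card_tuple //=.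
  exact: count_class_nonempty.
rewrite card_count_class_rec big_distrl /= factS -hc big_distrl /=.
rewrite [RHS](bigID (fun x => 0 < c x)%N) /= [X in (_ + X)%N]big1 ?addn0; last first.
  by move=> x; rewrite -eqn0Ngt => /eqP ->.
apply: eq_bigr => x cx.
have hx : (\sum_y (c y - (y == x)) = m)%N.
  have : (\sum_y (c y - (y == x)) + \sum_y (y == x) = m.+1)%N.
    rewrite -big_split -hc /=; apply: eq_bigr => y _.
    by apply: subnK; case: eqVneq => [->|].
  have -> : (\sum_y (y == x) = 1)%N.
    by rewrite (bigD1 x) //= eqxx big1 // => y /negbTE ->.
  by rewrite addn1 => -[].
rewrite -(IH _ hx) mulnCA; congr (_ * _)%N.
rewrite (bigD1 x) //= [X in (_ = _ * X)%N](bigD1 x) //= eqxx mulnA.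
congr (_ * _)%N; first by case: (c x) cx => // k _; rewrite factS subn1.
by apply: eq_bigr => y /negbTE ->; rewrite subn0.
Qed.

(** The quotient of the factorials is a product of consecutive integers, each above [c] when
    [c <= d] and at most [c] otherwise. *)
Lemma fact_expn_leq (c d : nat) : (c`! * c ^ d <= d`! * c ^ c)%N.
Proof.
have up k : (c`! * c ^ k <= (c + k)`!)%N.
  elim: k => [|k IH]; first by rewrite addn0 muln1.
  by rewrite addnS factS expnS mulnCA leq_mul // leqW // leq_addr.
have dn k j : ((j + k)`! <= j`! * (j + k) ^ k)%N.
  elim: k => [|k IH]; first by rewrite addn0 muln1.
  rewrite addnS factS expnS mulnCA leq_mul //.
  rewrite (leq_trans IH) // leq_mul //.
  by case: k {IH} => // k; rewrite leq_exp2r // leqnSn.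
have [cd|/ltnW dc] := leqP c d.
  by rewrite -{1}(subnKC cd) expnD mulnCA mulnC leq_mul // -{2}(subnKC cd).
rewrite -{4}(subnKC dc) expnD mulnCA [leqLHS]mulnC leq_mul //.
by have := dn (c - d)%N d; rewrite subnKC.
Qed.

(** For independent letters with probabilities proportional to [c x], the counts [c] are the most
    likely. The multinomial formula reduces this to [fact_expn_leq] for each letter. *)
Lemma count_class_mode (X : finType) (m : nat) (c d : X -> nat) :
  (\sum_x c x)%N = m -> (\sum_x d x)%N = m ->
  (#|count_class m d| * \prod_x c x ^ d x <= #|count_class m c| * \prod_x c x ^ c x)%N.
Proof.
move=> hc hd.
have f0 (e : X -> nat) : (0 < \prod_x (e x)`!)%N.
  by apply: prodn_gt0 => x; exact: fact_gt0.
rewrite -(leq_pmul2l (f0 d)) -(leq_pmul2l (f0 c)).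
have -> : (\prod_x (c x)`! * (\prod_x (d x)`! *
    (#|count_class m d| * \prod_x c x ^ d x)) =
    m`! * \prod_x ((c x)`! * c x ^ d x))%N.
  by rewrite -(card_count_class hd) big_split /=; ring.
have -> : (\prod_x (c x)`! * (\prod_x (d x)`! *
    (#|count_class m c| * \prod_x c x ^ c x)) =
    m`! * \prod_x ((d x)`! * c x ^ c x))%N.
  by rewrite -(card_count_class hc) big_split /=; ring.
by rewrite leq_mul2l leq_prod ?orbT // => x _; exact: fact_expn_leq.
Qed.

Lemma prod_count (R : comPzSemiRingType) (X : finType) (u : seq X) (f : X -> R) :
  \prod_(x <- u) f x = \prod_x f x ^+ count_mem x u.
Proof.
elim: u => [|a u IH]; first by rewrite big_nil big1.
rewrite big_cons IH (bigD1 a) //= [RHS](bigD1 a) //= eqxx exprS mulrA.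
by congr (_ * _); apply: eq_bigr => x /negbTE; rewrite eq_sym => ->.
Qed.

(** Expanding [(\sum_x c x) ^ m] and sorting strings by their counts gives at most [m.+1 ^ #|X|]
    classes, of which [c] contributes the most. *)
Lemma expn_leq_count_class (X : finType) (m : nat) (c : X -> nat) :
  (\sum_x c x)%N = m ->
  (m ^ m <= m.+1 ^ #|X| * (#|count_class m c| * \prod_x c x ^ c x))%N.
Proof.
move=> hc; rewrite -{1}hc -sum_tuple_prodn.
pose ty (w : m.-tuple X) : {ffun X -> 'I_m.+1} := [ffun x => inord (count_mem x w)].
have tyE w x : ty w x = count_mem x w :> nat.
  by rewrite ffunE inordK // ltnS (leq_trans (count_size _ _)) // size_tuple.
rewrite (partition_big ty predT) //= -[m.+1 in leqRHS]card_ord -card_ffun.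
rewrite -sum_nat_const; apply: leq_sum => t _.
apply: (@leq_trans (#|count_class m (fun x => t x : nat)| * \prod_x c x ^ t x)%N).
  rewrite -sum_nat_const [leqRHS]big_mkcond [leqLHS]big_mkcond /=.
  apply: leq_sum => w _; case: eqP => // <-.
  have -> : w \in count_class m (fun x => ty w x : nat) by apply/count_classP.
  rewrite -[leqLHS]/(\prod_(x <- w) (c x : nat))%R (@prod_count nat).
  by rewrite leq_eqVlt; apply/orP; left; apply/eqP/eq_bigr => x _; rewrite natrXE tyE.
have [ht|ht] := eqVneq (\sum_x (t x : nat))%N m; first exact: count_class_mode.
rewrite (_ : #|_| = 0%N) //; apply: eq_card0 => w; apply/negP => /count_classP h.
move/eqP: ht; apply; rewrite -[RHS](size_tuple w) -sum_count.
by apply: eq_bigr => x _; rewrite h.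
Qed.

(** The left side is the probability of the class under independent letters distributed by [P]. *)
Lemma card_count_class_le1 (R : realType) (X : finType) (m : nat) (c : X -> nat)
    (P : fdist R X) :
  #|count_class m c|%:R * \prod_x P x ^+ c x <= 1.
Proof.
apply: (@le_trans _ _ (\sum_(w : m.-tuple X) \prod_(x <- w) P x)); last first.
  by rewrite sum_tuple_prod pmf_sum1 expr1n.
rewrite mulr_natl -sumr_const.
rewrite [leRHS](bigID (mem (count_class m c))) /= -[leLHS]addr0 lerD //.
  apply: ler_sum => w /count_classP h.
  by rewrite (prod_count w) [leRHS](eq_bigr (fun x => P x ^+ c x)) // => x _; rewrite h.
apply: sumr_ge0 => w _; apply: prodr_ge0 => x _.
exact: Defs.pmf_ge0.
Qed.

(** * Sublinear sequences *)

(** An integer form of [k n / n -> 0], with [1 / q] as the tolerance; [C] absorbs small [n],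
    including 0. *)
Definition sublin (k : nat -> nat) : Prop :=
  forall q, exists C, forall n, (q * k n <= n + C)%N.

Lemma sublin_leq (k l : nat -> nat) :
  (forall n, k n <= l n)%N -> sublin l -> sublin k.
Proof.
move=> kl hl q; have [C hC] := hl q; exists C => n.
by rewrite (leq_trans _ (hC n)) // leq_mul.
Qed.

Lemma sublin_const (a : nat) : sublin (fun=> a).
Proof. by move=> q; exists (q * a)%N => n; rewrite leq_addl. Qed.

Lemma sublinD (k l : nat -> nat) :
  sublin k -> sublin l -> sublin (fun n => k n + l n)%N.
Proof.
move=> hk hl q; have [C hC] := hk (2 * q)%N; have [D hD] := hl (2 * q)%N.
by exists (C + D)%N => n; have := hC n; have := hD n; lia.
Qed.

Lemma sublinM (a : nat) (k : nat -> nat) : sublin k -> sublin (fun n => a * k n)%N.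
Proof. by move=> hk q; have [C hC] := hk (q * a)%N; exists C => n; rewrite mulnA. Qed.

Lemma sublin_sum (I : finType) (k : I -> nat -> nat) :
  (forall i, sublin (k i)) -> sublin (fun n => \sum_i k i n)%N.
Proof.
move=> hk; elim: (index_enum I) => [|i s IH].
  by apply: sublin_leq (sublin_const 0) => n; rewrite big_nil.
by apply: sublin_leq (sublinD (hk i) IH) => n; rewrite big_cons.
Qed.

Lemma sublin_up_log : sublin (fun n => up_log 2 n.+1).
Proof.
move=> q; exists (q * q.+1)%N => -[|n]; first by rewrite up_log1 muln0.
(* The constant covers [i <= q]; beyond that the right side grows by [2 ^ i > q] at each step. *)
have exp_bound i : (q * i.+1 <= 2 ^ i + q * q.+1)%N.
  elim: i => [|i IH]; first by rewrite muln1 mulnS; lia.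
  have [iq|qi] := leqP i.+2 q.+1; first by rewrite (leq_trans _ (leq_addl _ _)) // leq_mul.
  have : (q < 2 ^ i)%N by rewrite (leq_trans (ltn_expl q (ltnSn 1))) // leq_exp2l.
  by rewrite mulnS expnS; lia.
have := @up_log_bounds 2 n.+2 isT isT; case: (up_log 2 n.+2) => [|i] /=.
  by rewrite muln0.
by move=> /andP[h _]; have := exp_bound i; lia.
Qed.

(* The constant [K n] is the ceiling of [n * sup_(N >= n) k N / N], which is
   sublinear because the supremum tends to 0. *)
Lemma sublin_subadditive_majorant (k : nat -> nat) : sublin k ->
  exists K, sublin K /\
    forall (t : nat) (n : 'I_t -> nat), (0 < t)%N ->
      (k (\sum_(i < t) n i) <= \sum_(i < t) K (n i))%N.
Proof.
move=> hk.
(* The clause [k 0 <= j] serves the case in which all [n i] vanish. *)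
pose ok n j := (k 0 <= j)%N /\ forall N, (n <= N)%N -> (n * k N <= j * N)%N.
have exK n : exists j, `[< ok n j >].
  have [C hC] := hk 1%N; exists (n + n * C + k 0)%N; apply/asboolP.
  split; first by rewrite leq_addl.
  move=> N nN; case: N nN => [|N] nN; first by case: n nN.
  have := leq_mul (leqnn n) (hC N.+1); nia.
pose K n := ex_minn (exK n).
have Kok n : ok n (K n).
  by rewrite /K; case: ex_minnP => j /asboolP.
have Kmin n j : ok n j -> (K n <= j)%N.
  by move=> /asboolP okj; rewrite /K; case: ex_minnP => i _; apply.
exists K; split=> [q|t n t0].
  case: q => [|q]; first by exists 0%N.
  have [C hC] := hk (2 * q.+1)%N.
  exists (q.+1 * (1 + k 0) + \sum_(i < C) q.+1 * K i)%N => n.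
  have [nC|Cn] := ltnP n C.
    by rewrite (bigD1 (Ordinal nC)) //=; lia.
  suff : (K n <= n %/ q.+1 + 1 + k 0)%N.
    move=> h; have := leq_mul (leqnn q.+1) h; have := leq_divM n q.+1.
    by rewrite mulnC; lia.
  apply: Kmin; split=> [|N nN]; first by rewrite leq_addl.
  have qk : (q.+1 * k N <= N)%N by have := hC N; lia.
  have qn : (n <= q.+1 * (n %/ q.+1 + 1 + k 0))%N.
    by have := ltn_ceil n (ltn0Sn q); rewrite mulnC; lia.
  rewrite -(leq_pmul2l (ltn0Sn q)) mulnCA [leqRHS]mulnA [leqRHS]mulnC.
  by rewrite [leqRHS]mulnC; apply: leq_trans (leq_mul qn (leqnn N)); rewrite leq_mul.
set N := (\sum_(i < t) n i)%N.
have [N0|N0] := posnP N.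
  rewrite N0; case: t n t0 @N N0 => // t n _ N _.
  by rewrite big_ord_recl (leq_trans (Kok (n ord0)).1) // leq_addr.
rewrite -(leq_pmul2l N0) {1}/N big_distrl mulnC big_distrl /=.
apply: leq_sum => i _; apply: (Kok (n i)).2.
by rewrite /N (bigD1 i) //= leq_addr.
Qed.

(** Bernoulli's inequality for the [j]-th power of [1 - 1 / s.+1], with denominators cleared. *)
Lemma expn_succ_half (s j : nat) : (j <= s)%N ->
  (s.+1 ^ j * (s.+1 - j) <= s ^ j * s.+1)%N.
Proof.
elim: j => [|j IH] js; first by rewrite subn0.
have := IH (ltnW js); rewrite !expnS => h.
apply: (@leq_trans (s * (s.+1 ^ j * (s.+1 - j)))).
  have e : (s.+1 * (s.+1 - j.+1) <= s * (s.+1 - j))%N by have := js; nia.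
  by rewrite [leqLHS]mulnAC [leqRHS]mulnCA [leqRHS]mulnC leq_mul2r e orbT.
by rewrite -mulnA leq_mul2l h orbT.
Qed.

Lemma leq_expn2r (a b e : nat) : (a <= b)%N -> (a ^ e <= b ^ e)%N.
Proof. by case: e => // e ab; rewrite leq_exp2r. Qed.

(** Weight [x * s] in [card_codes] bounds the number of codes by [(x * s) ^ d * (1 + 1 / s) ^ m].
    The first factor is [2 ^ o(n)], and the second is at most about [2 ^ (m / t)] with [t] as large
    as desired. *)
Lemma sublin_codes (X : finType) (M : nat) (m d : nat -> nat) :
  (forall n, m n <= M * n.+1)%N -> sublin d ->
  sublin (fun n => up_log 2 #|codes X (m n) (d n)|).
Proof.
move=> hm hd q.
(* This [t] makes [2 * q * m n] at most [t * n.+1], and [s = 2 * t] gives [(1 + 1 / s) ^ t <= 2]. *)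
pose t := (2 * q * M).+1; pose s := (2 * t)%N; pose x := #|X|.+1.
pose L := up_log 2 (x * s).
have [C hC] := hd (2 * q * L)%N.
exists (2 * q + C + 1)%N => n.
set N := #|_|; set k := up_log 2 N.
have s0 : (0 < s)%N by rewrite /s /t; lia.
have st : (s.+1 ^ t <= 2 * s ^ t)%N.
  have := @expn_succ_half s t; rewrite (_ : s.+1 - t = t.+1)%N; last by rewrite /s; lia.
  have ts : (t <= s)%N by rewrite /s; lia.
  move=> /(_ ts) h; rewrite -(leq_pmul2r (ltn0Sn t)) (leq_trans h) //.
  by rewrite mulnAC mulnC leq_mul2r; apply/orP; right; rewrite /s; lia.
have Ns : (N * s ^ m n <= (x * s) ^ d n * s.+1 ^ m n)%N.
  have x0 : (0 < x ^ m n)%N by rewrite expn_gt0.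
  have := card_codes X (m n) (d n) (x * s); rewrite -/N => h.
  rewrite -(leq_pmul2l x0) mulnCA -expnMn (leq_trans h) // mulnCA leq_mul2l.
  rewrite -expnMn; apply/orP; right.
  by apply: leq_expn2r; rewrite mulnS /x; lia.
have Nt : (N ^ t <= 2 ^ (L * d n * t + m n))%N.
  have sm0 : (0 < s ^ (m n * t))%N by rewrite expn_gt0 s0.
  rewrite -(leq_pmul2r sm0) [(s ^ _)%N]expnM -expnMn.
  apply: leq_trans (leq_expn2r t Ns) _.
  rewrite expnMn expnD -mulnA leq_mul //.
    rewrite -expnM -mulnA [leqRHS]expnM; apply: leq_expn2r.
    exact: up_logP.
  rewrite -!expnM [(m n * t)%N]mulnC !expnM -expnMn.
  exact: leq_expn2r.
have kb : (t * k <= t + (L * d n * t + m n))%N.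
  have [N1|N1] := leqP N 1.
    by rewrite (_ : k = 0%N) ?muln0 // /k; move: N1; case: (N) => [|[|]] // _; rewrite ?up_log0 ?up_log1.
  have /andP[h _] := @up_log_bounds 2 N isT N1.
  have k1 : (k = k.-1.+1)%N by rewrite prednK // /k up_log_gt0 // ltnW.
  suff : (k.-1 * t <= L * d n * t + m n)%N by rewrite {2}k1 mulnS [(t * _)%N]mulnC; lia.
  by rewrite -(@leq_exp2l 2) // (leq_trans _ Nt) // expnM leq_exp2r // ltnW.
have h1 : (2 * q * (t * k) <= 2 * q * (t + (L * d n * t + m n)))%N.
  by rewrite leq_mul2l kb orbT.
have h2 := leq_mul (hC n) (leqnn t).
have h3 := leq_mul (leqnn (2 * q)) (hm n).
have h4 : (2 * q * (M * n.+1) <= t * n.+1)%N.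
  by rewrite mulnA leq_mul2r /t leqnSn orbT.
have h5 : (t * (2 * (q * k)) <= t * (2 * q + (n + C) + n.+1))%N.
  apply: leq_trans (_ : 2 * q * t + (n + C) * t + t * n.+1 <= _)%N; last by lia.
  apply: leq_trans (_ : 2 * q * (t * k) <= _)%N; first by lia.
  apply: leq_trans h1 _; rewrite !mulnDr -addnA !leq_add //.
    by apply: leq_trans h2; lia.
  exact: leq_trans h3 h4.
by move: h5; rewrite leq_mul2l /= => h5; lia.
Qed.

(** * A lower bound for the probability of a type class *)

Local Open Scope classical_set_scope.

(** For [c > 0] put [y = m p]. Then [c <= y + 1 <= y * expR (1 / y)], and the [c]-th power of the
    exponential is at most [expR ((y + 1) / y)], hence at most [expR (1 + B)]. *)
Lemma expr_leq_expR_type (R : realType) (m c : nat) (p B : R) :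
  0 <= p -> ((0 < c)%N -> 0 < p) -> (c <= m)%N -> c%:R <= m%:R * p + 1 -> p^-1 <= B ->
  c%:R ^+ c <= expR (1 + B) * (m%:R * p) ^+ c.
Proof.
move=> p0 cp cm cmp pB.
have B0 : 0 <= B by rewrite (le_trans _ pB) // invr_ge0.
have [c0|c0] := posnP c.
  by rewrite c0 !expr0 mulr1 (le_trans _ (expR_ge1Dx _)) // lerDl addr_ge0.
have pp := cp c0; set y := m%:R * p in cmp *.
have m1 : (1 : R) <= m%:R by rewrite ler1n (leq_trans c0).
have y0 : 0 < y by rewrite mulr_gt0 // (lt_le_trans _ m1).
have yB : y^-1 <= B.
  by rewrite (le_trans _ pB) // lef_pV2 ?posrE // ler_peMl.
have cy : c%:R <= y * expR (y^-1).
  apply: le_trans cmp _; rewrite -[1 in leLHS](divff (lt0r_neq0 y0)) -[y in y + _]mulr1 -mulrDr.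
  by rewrite ler_pM2l // expR_ge1Dx.
apply: le_trans (_ : (y * expR y^-1) ^+ c <= _).
  by rewrite lerXn2r ?nnegrE ?mulr_ge0 ?expR_ge0 // ltW.
rewrite exprMn mulrC ler_pM2r ?exprn_gt0 // -expRM_natl ler_expR.
apply: le_trans (_ : (y + 1) * y^-1 <= _); last by rewrite mulrDl divff ?lt0r_neq0 // mul1r lerD2l.
by rewrite ler_pM2r ?invr_gt0.
Qed.

(** In [expn_leq_count_class] each [c x ^ c x] is replaced by [(m P x) ^ c x] at constant cost; the
    powers of [m] then cancel against [m ^ m]. *)
Lemma type_class_lower (R : realType) (X : finType) (m : nat) (c : X -> nat)
    (P : fdist R X) (B : R) :
  (\sum_x c x)%N = m -> (forall x, (0 < c x)%N -> 0 < P x) ->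
  (forall x, (c x)%:R <= m%:R * P x + 1) -> (forall x, (P x)^-1 <= B) ->
  1 <= m.+1%:R ^+ #|X| * expR (1 + B) ^+ #|X| *
       (#|count_class m c|%:R * \prod_x P x ^+ c x).
Proof.
move=> hc cP cmP PB.
have mm0 : 0 < (m ^ m)%:R :> R by rewrite ltr0n expn_gt0; case: (m).
have := expn_leq_count_class hc; rewrite -(ler_nat R) !natrM !natrX natr_prod => h.
rewrite -(ler_pM2r mm0) mul1r natrX (le_trans h) //.
rewrite -!mulrA ler_wpM2l ?exprn_ge0 // mulrCA ler_wpM2l //.
apply: le_trans (_ : \prod_x (expR (1 + B) * (m%:R * P x) ^+ c x) <= _).
  apply: ler_prod => x _; rewrite natrX exprn_ge0 //=.
  apply: expr_leq_expR_type => //; first exact: Defs.pmf_ge0.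
    exact: cP.
  by rewrite -hc (bigD1 x) //= leq_addr.
rewrite big_split /= prodr_const ler_wpM2l ?exprn_ge0 ?expR_ge0 //.
under eq_bigr do rewrite exprMn.
by rewrite big_split /= prodrXr hc mulrC.
Qed.

Lemma leq_exp2_nat (R : realType) (r : R) : exists k, r <= (2 ^ k)%:R.
Proof.
have [r0|r0] := leP r 0; first by exists 0%N; rewrite (le_trans r0).
exists (Num.truncn r).+1; apply: le_trans (ltW (truncnS_gt r)) _.
by rewrite ler_nat ltnW // ltn_expl.
Qed.

(** * Limits of quotients by [n], and rounding *)

Lemma sublin_sublinear (R : realType) (k : nat -> nat) : sublin k -> sublinear R k.
Proof.
move=> hk; apply/cvgrPdist_le => e e0.
have [q hq] : exists q : nat, 2 / e <= q%:R.
  by exists (Num.truncn (2 / e)).+1; rewrite ltW // truncnS_gt.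
have [C hC] := hk q; exists (maxn C 1) => // n /=; rewrite geq_max => /andP[Cn n0].
rewrite sub0r normrN ger0_norm ?divr_ge0 // ler_pdivrMr ?ltr0n //.
have : (q * k n)%:R <= (2 * n)%:R :> R.
  by rewrite ler_nat (leq_trans (hC n)) // mul2n -addnn leq_add2l.
rewrite !natrM => h.
have : 2 / e * (k n)%:R <= 2 * n%:R by rewrite (le_trans _ h) // ler_wpM2r.
by rewrite mulrAC ler_pdivrMr // -mulrA ler_pM2l // mulrC.
Qed.

Definition linear_growth (R : realType) (f : nat -> nat) (v : R) : Prop :=
  (fun n => (f n)%:R / n%:R : R) @ \oo --> v.

Lemma linear_growth_bound (R : realType) (f : nat -> nat) (v : R) :
  linear_growth f v -> exists M, forall n, (f n <= M * n.+1)%N.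
Proof.
move=> /cvgrPdist_le /(_ 1 ltr01) [n0 _ hn].
pose a := (Num.truncn (v + 1)).+1.
exists (a + \sum_(i < n0.+1) f i)%N => n.
have [nn|nn] := ltnP n n0.+1.
  rewrite (bigD1 (Ordinal nn)) //= mulnS; lia.
rewrite (@leq_trans (a * n)) //; last by rewrite leq_mul // leq_addr.
have n1 : 0 < n%:R :> R by rewrite ltr0n; lia.
have := hn n (ltnW nn); rewrite ler_norml => /andP[h _].
rewrite -(ler_nat R) natrM -ler_pdivrMr //.
apply: le_trans (ltW (truncnS_gt (v + 1))); lra.
Qed.

Lemma linear_growth_sub (R : realType) (f g : nat -> nat) (v : R) :
  linear_growth f v -> linear_growth g v -> sublin (fun n => f n - g n)%N.
Proof.
move=> hf hg q.
have : (fun n => (f n)%:R / n%:R - (g n)%:R / n%:R : R) @ \oo --> v - v by exact: cvgB.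
rewrite subrr => /cvgrPdist_le h.
have q0 : 0 < (q.+1%:R)^-1 :> R by rewrite invr_gt0 ltr0n.
have [n0 _ hn] := h _ q0.
exists (\sum_(i < n0.+1) q * (f i - g i))%N => n.
have [nn|nn] := ltnP n n0.+1.
  by rewrite (bigD1 (Ordinal nn)) //=; lia.
apply: leq_trans (leq_addr _ _).
have n1 : 0 < n%:R :> R by rewrite ltr0n; lia.
have := hn n (ltnW nn); rewrite sub0r normrN ler_norml => /andP[_].
rewrite -mulrBl ler_pdivrMr // mulrC ler_pdivlMr ?ltr0n // => hle.
have [gf|fg] := leqP (g n) (f n); last by rewrite (_ : f n - g n = 0)%N; lia.
rewrite -(ler_nat R) natrM natrB //.
apply: le_trans hle; rewrite mulrC ler_wpM2l ?subr_ge0 ?ler_nat //.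
Qed.

Lemma linear_growth_near (R : realType) (f : nat -> nat) (v : R) :
  (forall n, `|n%:R * v - (f n)%:R| <= 1) -> linear_growth f v.
Proof.
move=> hf; apply/cvgrPdist_le => e e0.
exists (Num.truncn e^-1).+1 => // n /= en.
have n1 : 0 < n%:R :> R by rewrite ltr0n; apply: leq_trans en.
have -> : v - (f n)%:R / n%:R = (n%:R * v - (f n)%:R) / n%:R.
  by rewrite mulrBl mulrAC divff ?mul1r // lt0r_neq0.
rewrite normrM normfV [`|n%:R|]ger0_norm // ler_pdivrMr //.
apply: le_trans (hf n) _; rewrite mulrC -ler_pdivrMr // mul1r.
by apply: le_trans (ltW (truncnS_gt _)) _; rewrite ler_nat.
Qed.

Definition natceil (R : realType) (x : R) : nat := `|Num.ceil x|%N.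

Lemma natceil_itv (R : realType) (x : R) : 0 <= x -> x <= (natceil x)%:R < x + 1.
Proof.
move=> x0; rewrite /natceil natr_absz ger0_norm ?ceil_ge0 ?(lt_le_trans _ x0) //.
by have := ceil_itv x; rewrite intrB ltrBlDr andbC.
Qed.

Lemma linear_growth_truncn (R : realType) (v : R) : 0 <= v ->
  linear_growth (fun n => Num.truncn (n%:R * v)) v.
Proof.
move=> v0; apply: linear_growth_near => n.
have /andP[h1 h2] := truncn_itv (mulr_ge0 (ler0n R n) v0).
by rewrite ler_norml; move: h2; rewrite -natr1; lra.
Qed.

Lemma linear_growth_natceil (R : realType) (v : R) : 0 <= v ->
  linear_growth (fun n => natceil (n%:R * v)) v.
Proof.
move=> v0; apply: linear_growth_near => n.
have /andP[h1 h2] := natceil_itv (mulr_ge0 (ler0n R n) v0).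
by rewrite ler_norml; lra.
Qed.

Lemma type_graphE (R : realType) (G : graph) (m : nat) (P : fdist R G) :
  is_type m P -> exists c : G -> nat,
    [/\ type_graph m P = count_graph m c, (\sum_x c x)%N = m &
        forall x, (c x)%:R = m%:R * P x].
Proof.
move=> hP; exists (fun x => Num.truncn (m%:R * P x)).
have cP x : (Num.truncn (m%:R * P x))%:R = m%:R * P x by rewrite truncnK //; exact: hP.
split=> //; last first.
  apply/eqP; rewrite -(eqr_nat R) natr_sum; under eq_bigr do rewrite cP.
  by rewrite -mulr_sumr pmf_sum1 mulr1.
rewrite /type_graph /count_graph; congr (@Defs.induced _ _).
apply/setP => u; rewrite !inE; apply: eq_forallb => x.
by rewrite -{1}cP eqr_nat.
Qed.

(** * Comparison and covering along sequences of counts *)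

Lemma cle_linear_growth (R : realType) (G : graph) (v : G -> R) (m m' : nat -> nat)
    (c c' : nat -> G -> nat) :
  (forall n, (\sum_x c n x)%N = m n) -> (forall n, (\sum_x c' n x)%N = m' n) ->
  (forall x, linear_growth (c^~ x) (v x)) -> (forall x, linear_growth (c'^~ x) (v x)) ->
  exists k, sublin k /\
    forall n, cle (2 ^ k n) (count_graph (m n) (c n)) (count_graph (m' n) (c' n)).
Proof.
move=> cm cm' cv cv'; exists (fun n =>
  up_log 2 #|codes G (m n) (\sum_x (c n x - c' n x))|); split; last first.
  by move=> n; apply: cle_leq (cle_count (cm n) (cm' n)); exact: up_logP.
have [M hM] := fin_all_exists (fun x => linear_growth_bound (cv x)).
apply: (@sublin_codes _ (\sum_x M x)%N m).
  by move=> n; rewrite -cm big_distrl; apply: leq_sum => x _; exact: hM.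
by apply: sublin_sum => x; exact: linear_growth_sub (cv x) (cv' x).
Qed.

Lemma exists_sublin_log (M : nat) (f : nat -> nat) : (forall n, f n <= M * n.+1)%N ->
  exists r, sublin r /\ forall n, ((f n).+1 <= 2 ^ r n)%N.
Proof.
move=> hf; exists (fun n => up_log 2 M.+1 + up_log 2 n.+1)%N; split.
  by apply: sublinD; [exact: sublin_const|exact: sublin_up_log].
move=> n; rewrite expnD; apply: leq_trans (leq_mul (up_logP M.+1 _) (up_logP n.+1 _)) => //.
by have := hf n; rewrite mulSn; lia.
Qed.

(** Bounds a factor linear in a sum by a product over the indices, so that its logarithm can be
    charged to the single indices. *)
Lemma sum_ltn_prod (t : nat) (f : 'I_t -> nat) :
  (\sum_(i < t) f i < \prod_(i < t) (f i).+1)%N.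
Proof.
elim: t f => [|t IH] f; first by rewrite !big_ord0.
rewrite !big_ord_recl; have := IH (fun i => f (lift ord0 i)).
set s := (\sum_(i < t) _)%N; set p := (\prod_(i < t) _)%N; nia.
Qed.

(** The product is embedded by concatenation and covers by permuting positions. Since the powers of
    [P] multiply over [i], the ratio of cardinalities is at most the product of the losses in
    [type_class_lower]. *)
Lemma cle_ceil_prod (R : realType) (G : graph) (mu : R) (P : fdist R G) (m : nat -> nat)
    (c : nat -> G -> nat) :
  0 <= mu -> (forall n x, c n x = natceil (n%:R * (mu * P x))) ->
  (forall n, (\sum_x c n x)%N = m n) ->
  exists r, sublin r /\ forall t (n : 'I_t -> nat),
    cle (2 ^ \sum_(i < t) r (n i))
      (count_graph (\sum_(i < t) m (n i)) (fun x => \sum_(i < t) c (n i) x)%N)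
      (strong_prod (fun i => count_graph (m (n i)) (c (n i)))).
Proof.
move=> mu0 cE cm.
have P0 x : 0 <= P x := Defs.pmf_ge0 P x.
have v0 n x : 0 <= n%:R * (mu * P x) by rewrite !mulr_ge0.
have c_itv n x : n%:R * (mu * P x) <= (c n x)%:R < n%:R * (mu * P x) + 1.
  by rewrite cE natceil_itv.
have nm n : n%:R * mu <= (m n)%:R.
  have -> : n%:R * mu = \sum_x n%:R * mu * P x by rewrite -mulr_sumr pmf_sum1 mulr1.
  rewrite -cm natr_sum.
  by apply: ler_sum => x _; rewrite -mulrA; case/andP: (c_itv n x).
(* The ceiling is strictly below its argument plus 1, so letters with [P x = 0] have count 0. *)
have cP n x : (0 < c n x)%N -> 0 < P x.
  move=> c0; rewrite lt_neqAle P0 andbT; apply/eqP => Px.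
  have /andP[_] := c_itv n x; rewrite -Px !mulr0 add0r ltrn1.
  by case: (c n x) c0.
(* Rounding up gives [n mu <= m n], which makes the bound relative to [m n]. *)
have c_le n x : (c n x)%:R <= (m n)%:R * P x + 1.
  have /andP[_ /ltW h] := c_itv n x; rewrite (le_trans h) // lerD2r mulrA.
  by rewrite ler_wpM2r.
(* The inverse of 0 is 0, so only letters of positive probability contribute. *)
pose B := \sum_x (P x)^-1.
have PB x : (P x)^-1 <= B.
  by rewrite /B (bigD1 x) //= lerDl sumr_ge0 // => y _; rewrite invr_ge0.
have [k hk] := leq_exp2_nat (expR (1 + B) ^+ #|G|).
have [M hM] : exists M, forall n, (m n <= M * n.+1)%N.
  have growth x : linear_growth (c^~ x) (mu * P x).
    rewrite (_ : c^~ x = fun n => natceil (n%:R * (mu * P x))).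
      by apply: linear_growth_natceil; rewrite mulr_ge0.
    by apply/funext => n; exact: cE.
  have [M hM] := fin_all_exists (fun x => linear_growth_bound (growth x)).
  exists (\sum_x M x)%N => n.
  by rewrite -cm big_distrl; apply: leq_sum => x _; exact: hM.
have [r1 [sr1 hr1]] := exists_sublin_log hM.
(* There are at most [2 ^ (a * N)] strings of length [N], so [(a * N).+1] halving rounds suffice for
   the cover. *)
pose a := up_log 2 #|G|.
have [r2 [sr2 hr2]] : exists r, sublin r /\ forall n, ((a * m n).+1 <= 2 ^ r n)%N.
  apply: (@exists_sublin_log (a * M)) => n.
  by rewrite -mulnA leq_mul2l hM orbT.
(* An exponent for the loss in [type_class_lower]: [r1] for [m.+1], once per letter, and [k] for the
   constant. *)
pose r n := (#|G| * r1 n + k)%N.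
exists (fun n => r n + r2 n)%N; split.
  by apply: sublinD sr2; apply: sublinD (sublin_const k); exact: sublinM.
move=> t n; set S := strong_prod _; pose C x := (\sum_(i < t) c (n i) x)%N; rewrite -/C; set N := (\sum_(i < t) m (n i))%N.
have CN : (\sum_x C x)%N = N.
  by rewrite exchange_big /=; apply: eq_bigr => i _; rewrite cm.
rewrite big_split /= expnD.
apply: (@cle_leq ((2 ^ \sum_(i < t) r (n i)) * (a * N).+1)).
  rewrite leq_mul2l expn_sum big_distrr /=; apply/orP; right.
  by apply: leq_trans (sum_ltn_prod _) _; apply: leq_prod => i _; exact: hr2.
have lower n' : 1 <= (2 ^ r n')%:R *
    (#|count_class (m n') (c n')|%:R * \prod_x P x ^+ c n' x).
  apply: le_trans (type_class_lower (cm n') (cP n') (c_le n') PB) _.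
  apply: ler_wpM2r.
    by rewrite mulr_ge0 // prodr_ge0 // => x _; exact: exprn_ge0.
  rewrite expnD natrM ler_pM ?exprn_ge0 ?expR_ge0 //.
  by rewrite mulnC expnM natrX lerXn2r ?nnegrE // ler_nat.
apply: cle_count_cover.
- exact: embeds_strong_prod.
- by rewrite expn_gt0.
- have Q0 : 0 < \prod_x P x ^+ C x.
    apply: prodr_gt0 => x _; have [->|] := posnP (C x); first by rewrite expr0.
    rewrite lt0n sum_nat_eq0 negb_forall => /existsP[i]; rewrite -lt0n => ci.
    by rewrite exprn_gt0 // (cP _ _ ci).
  (* After multiplication by [\prod_x P x ^+ C x] the left side is at most 1, and the right side
     splits into factors that are at least 1 by [lower]. *)
  rewrite -(ler_nat R) -(ler_pM2r Q0); apply: le_trans (card_count_class_le1 _ _ _) _.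
  rewrite card_strong_prod natrM expn_sum !natr_prod.
  have -> : \prod_x P x ^+ C x = \prod_(i < t) \prod_x P x ^+ c (n i) x.
    by rewrite exchange_big /=; apply: eq_bigr => x _; rewrite prodrXr.
  rewrite -!big_split /=; apply: le_trans (_ : \prod_(i < t) 1 <= _).
    by rewrite big1_eq.
  apply: ler_prod => i _; rewrite ler01 /= card_count_graph -mulrA.
  exact: lower.
- apply: (@leq_trans (2 ^ (a * N)).+1); last by rewrite ltn_exp2l.
  rewrite ltnS (leq_trans (max_card _)) // card_tuple expnM leq_expn2r //.
  exact: up_logP.
Qed.

(** * Floors and ceilings of sums *)

Lemma floor_sum_leq (R : realType) (t : nat) (n : 'I_t -> nat) (v : R) : 0 <= v ->
  (\sum_(i < t) Num.truncn ((n i)%:R * v) <= Num.truncn ((\sum_(i < t) n i)%:R * v))%N.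
Proof.
move=> v0; rewrite truncn_ge_nat ?mulr_ge0 // !natr_sum mulr_suml.
by apply: ler_sum => i _; rewrite truncn_le mulr_ge0.
Qed.

Lemma natceil_sum_leq (R : realType) (t : nat) (n : 'I_t -> nat) (v : R) : 0 <= v ->
  (natceil ((\sum_(i < t) n i)%:R * v) <= \sum_(i < t) natceil ((n i)%:R * v))%N.
Proof.
move=> v0.
have h N : N%:R * v <= (natceil (N%:R * v))%:R < N%:R * v + 1.
  by apply: natceil_itv; rewrite mulr_ge0.
rewrite -ltnS -(ltr_nat R) -natr1; have /andP[_ /lt_le_trans] := h (\sum_(i < t) n i)%N.
apply; rewrite lerD2r !natr_sum mulr_suml.
by apply: ler_sum => i _; case/andP: (h (n i)).
Qed.

(** * From type sequences to letter counts, and the asymptotic claims *)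

Lemma type_sequence_counts (R : realType) (G : graph) (mu : R) (P : fdist R G)
    (m : nat -> nat) (Pn : nat -> fdist R G) :
  type_sequence mu P m Pn -> exists c : nat -> G -> nat,
    [/\ forall n, type_graph (m n) (Pn n) = count_graph (m n) (c n),
        forall n, (\sum_x c n x)%N = m n &
        forall x, linear_growth (c^~ x) (mu * P x)].
Proof.
move=> [mv hP Pv].
have [c hc] := choice (fun n => type_graphE (hP n)).
exists c; split=> [n|n|x]; [by have [] := hc n|by have [] := hc n|].
rewrite /linear_growth.
have -> : (fun n => (c n x)%:R / n%:R : R) = (fun n => (m n)%:R / n%:R * Pn n x).
  by apply/funext => n; have [_ _ ->] := hc n; rewrite mulrAC.
exact: cvgM.
Qed.

Theorem theorem5p26 (R : realType) (G : graph) (mu : R) (P : fdist R G)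
    (m : nat -> nat) (Pn : nat -> fdist R G) (hmu : 0 <= mu)
    (hmP : type_sequence mu P m Pn) :
  approx_geometric R (fun n => type_graph (m n) (Pn n)) /\
  (forall (m' : nat -> nat) (Pn' : nat -> fdist R G),
     type_sequence mu P m' Pn' ->
     asymp_equiv R (fun n => type_graph (m n) (Pn n))
                   (fun n => type_graph (m' n) (Pn' n))).
Proof.
have [c [cE cm cv]] := type_sequence_counts hmP.
split; last first.
  move=> m' Pn' hmP'; have [c' [cE' cm' cv']] := type_sequence_counts hmP'.
  have [k [sk hk]] := cle_linear_growth cm cm' cv cv'.
  have [k' [sk' hk']] := cle_linear_growth cm' cm cv' cv.
  exists (fun n => k n + k' n)%N; split; first exact/sublin_sublinear/sublinD.
  move=> n; rewrite cE cE'; split.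
    by apply: cle_cohom_le (hk n); rewrite leq_exp2l // leq_addr.
  by apply: cle_cohom_le (hk' n); rewrite leq_exp2l // leq_addl.
(* Every type has a string, also at length 0, so the alternative with nonempty graphs holds. *)
right; split.
  by move=> n; rewrite cE card_count_graph; exact: count_class_nonempty.
have v0 x : 0 <= mu * P x by rewrite mulr_ge0 // Defs.pmf_ge0.
(* Floors [f] and ceilings [u] grow like the given counts; [mf] and [mu'] are the lengths of their
   strings. *)
pose f n x := Num.truncn (n%:R * (mu * P x)).
pose u n x := natceil (n%:R * (mu * P x)).
pose mf n := (\sum_x f n x)%N; pose mu' n := (\sum_x u n x)%N.
have fv x : linear_growth (f^~ x) (mu * P x) by exact: linear_growth_truncn.
have uv x : linear_growth (u^~ x) (mu * P x) by exact: linear_growth_natceil.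
have [k1 [sk1 hk1]] := @cle_linear_growth _ _ _ _ mf _ _ cm (fun=> erefl) cv fv.
have [k2 [sk2 hk2]] := @cle_linear_growth _ _ _ mf _ _ _ (fun=> erefl) cm fv cv.
have [k3 [sk3 hk3]] := @cle_linear_growth _ _ _ _ mu' _ _ cm (fun=> erefl) cv uv.
have [k4 [sk4 hk4]] := @cle_linear_growth _ _ _ mu' _ _ _ (fun=> erefl) cm uv cv.
have [k5 [sk5 hk5]] := @cle_ceil_prod _ _ _ P mu' u hmu (fun _ _ => erefl) (fun=> erefl).
(* The costs [k2] and [k3] arise at the sum of the [n i]; the majorants charge them to the single
   [n i]. *)
have [K2 [sK2 hK2]] := sublin_subadditive_majorant sk2.
have [K3 [sK3 hK3]] := sublin_subadditive_majorant sk3.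
exists (fun n => k1 n + K2 n + (K3 n + k5 n + k4 n))%N; split.
  by apply/sublin_sublinear; do ![apply: sublinD|].
move=> t n t0 /=.
have -> : strong_prod (fun i => type_graph (m (n i)) (Pn (n i))) =
    strong_prod (fun i => count_graph (m (n i)) (c (n i))).
  by congr strong_prod; apply/funext => i; exact: cE.
rewrite cE !big_split /=; set N := (\sum_(i < t) n i)%N; split.
(* From the given counts to floors in each factor, by concatenation to the sum of floors, then to
   the floor of the sum and back to the counts at [N]. *)
- have h1 := cle_strong_prod (fun i => hk1 (n i)).
  have h2 := embeds_cle (@embeds_strong_prod G t (fun i => mf (n i)) (fun i => f (n i))
    (fun x => \sum_(i < t) f (n i) x)%N (fun=> erefl)).
  have h3 : cle 1 (count_graph (\sum_(i < t) mf (n i))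
      (fun x => \sum_(i < t) f (n i) x)%N) (count_graph (mf N) (f N)).
    apply: cle_count_mono => [|//|x]; first by rewrite exchange_big.
    exact: floor_sum_leq.
  apply: cle_cohom_le (cle_trans h1 (cle_trans h2 (cle_trans h3 (hk2 N)))).
  rewrite !mul1n -expn_sum -expnD leq_exp2l //.
  by apply: leq_trans (leq_addr _ _); rewrite leq_add2l; exact: hK2.
(* From the counts at [N] to their ceilings, up to the sum of ceilings, by covering to the product,
   and back to the given counts in each factor. *)
- have h1 : cle 1 (count_graph (mu' N) (u N)) (count_graph (\sum_(i < t) mu' (n i))
      (fun x => \sum_(i < t) u (n i) x)%N).
    apply: cle_count_mono => [//||x]; first by rewrite exchange_big.
    exact: natceil_sum_leq.
  have h2 := cle_strong_prod (fun i => hk4 (n i)).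
  apply: cle_cohom_le (cle_trans (hk3 N) (cle_trans h1 (cle_trans (hk5 t n) h2))).
  rewrite mul1n -expn_sum -!expnD leq_exp2l // addnA.
  by apply: leq_trans (leq_addl _ _); rewrite !leq_add2r; exact: hK3.
Qed.
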